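(* Consider the equation $$u_{tx}=(1-\partial_x^2)\sin(u),\qquad x\in\mathbb{R},\ t>0.$$ (A) For any $-1<c<1$, $c\ne0$, and $n\in\mathbb{Z}$, there exists: (A1) a cusped traveling-wave solution $u(x,t)=\varphi(x-ct)$ such that $$\lim_{x\to\pm\infty}\varphi(x)=2n\pi,\qquad\max_{x\in\mathbb{R}}\varphi(x)=2n\pi+\arccos(c),\qquad\inf_{x\in\mathbb{R}}\varphi(x)=2n\pi.$$ The maximum is attained at some point $x_c$, and near $x_c$ the behavior of $\varphi(x)$ is given by $$|\varphi(x)-\varphi_0|=\sqrt2\left(\frac{1-c}{1+c}\right)^{1/4}\sqrt{|x-x_c|}+O(x-x_c),\qquad x\to x_c,$$ with $\varphi_0=2n\pi+\arccos(c)$; (A2) an anticusped traveling-wave solution $u(x,t)=\varphi(x-ct)$ such that $$\lim_{x\to\pm\infty}\varphi(x)=2n\pi,\qquad\min_{x\in\mathbb{R}}\varphi(x)=2n\pi-\arccos(c),\qquad\sup_{x\in\mathbb{R}}\varphi(x)=2n\pi.$$ The minimum is attained at some point $x_c$, and near $x_c$ the behavior of $\varphi(x)$ is given by the same formula as in (A1) with $\varphi_0=2n\pi-\arccos(c)$. (B) For $c=-1$ and any $n\in\mathbb{Z}$, there exists: (B1) a cusped traveling-wave solution $u(x,t)=\varphi(x-ct)$ such that $$\lim_{x\to\pm\infty}\varphi(x)=2n\pi,\qquad\max_{x\in\mathbb{R}}\varphi(x)=(2n+1)\pi,\qquad\inf_{x\in\mathbb{R}}\varphi(x)=2n\pi.$$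 The maximum is attained at some point $x_c$, and near $x_c$ the behavior of $\varphi(x)$ is given by $$|\varphi(x)-\varphi_0|=12^{1/3}|x-x_c|^{1/3}+O(|x-x_c|^{2/3}),\qquad x\to x_c,$$ with $\varphi_0=(2n+1)\pi$; (B2) an anticusped traveling-wave solution $u(x,t)=\varphi(x-ct)$ such that $$\lim_{x\to\pm\infty}\varphi(x)=2n\pi,\qquad\min_{x\in\mathbb{R}}\varphi(x)=(2n-1)\pi,\qquad\sup_{x\in\mathbb{R}}\varphi(x)=2n\pi.$$ The minimum is attained at some point $x_c$, and near $x_c$ the behavior of $\varphi(x)$ is given by the same formula as in (B1) with $\varphi_0=(2n-1)\pi$.
   Context: A function $\varphi:\mathbb{R}\to\mathbb{R}$ has a cusp at $x=x_c$ if it is continuous, smooth locally on both sides of $x_c$, and $\lim_{x\uparrow x_c}\varphi_x(x)=-\lim_{x\downarrow x_c}\varphi_x(x)=\pm\infty$. A cusp at which $\varphi$ has a minimum is called an anticusp. For $u(x,t)=\varphi(x-ct)$ the equation $u_{tx}=(1-\partial_x^2)\sin(u)$ becomes $(\cos(\varphi)-c)\varphi_{xx}=\sin(\varphi)+\varphi_x^2\sin(\varphi)$, which integrates to $$\varphi_x^2=\frac{b^2-(c-\cos\varphi)^2}{(c-\cos\varphi)^2}$$ with an integration constant $b>0$; the waves considered here have $b=|c-1|$. A cusped (respectively anticusped) traveling-wave solution means here a continuous function $\varphi$ on $\mathbb{R}$, smooth on $\mathbb{R}\setminus\{x_c\}$, having a cusp (respectively an anticusp) at $x_c$, and satisfying,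 pointwise away from $x_c$, the ordinary differential equations $(\cos(\varphi)-c)\varphi_{xx}=\sin(\varphi)+\varphi_x^2\sin(\varphi)$ and $\varphi_x^2=\frac{(c-1)^2-(c-\cos\varphi)^2}{(c-\cos\varphi)^2}$, so that $u(x,t)=\varphi(x-ct)$ satisfies the partial differential equation $u_{tx}=(1-\partial_x^2)\sin(u)$ pointwise where $x-ct\ne x_c$; no weak formulation across the cusp is asserted. *)

(* Defs.v *)
From Stdlib Require Import Reals ZArith.
From Coquelicot Require Import Coquelicot.
Open Scope R_scope.

Definition smooth_on (D : R -> Prop) (f : R -> R) : Prop :=
  forall (k : nat) (x : R), D x -> ex_derive_n f k x.

Definition has_cusp (f : R -> R) (xc : R) : Prop :=
  (forall x : R, continuous f x) /\
  (exists eps : R, 0 < eps /\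
     smooth_on (fun x => xc - eps < x < xc) f /\
     smooth_on (fun x => xc < x < xc + eps) f) /\
  ((filterlim (Derive f) (at_left xc) (Rbar_locally p_infty) /\
    filterlim (Derive f) (at_right xc) (Rbar_locally m_infty)) \/
   (filterlim (Derive f) (at_left xc) (Rbar_locally m_infty) /\
    filterlim (Derive f) (at_right xc) (Rbar_locally p_infty))).

Definition has_anticusp (f : R -> R) (xc : R) : Prop :=
  has_cusp f xc /\ locally xc (fun x => f xc <= f x).

(** [u_tx = (1 - d_x^2) sin u] at [(x, t)].  [Derive] is a total operator, so
    the existence of the derivatives involved is required explicitly. *)
Definition pde_at (u : R -> R -> R) (x t : R) : Prop :=
  locally x (fun y => ex_derive (fun s => u y s) t) /\
  ex_derive (fun y => Derive (fun s => u y s) t) x /\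
  locally x (fun y => ex_derive (fun z => sin (u z t)) y) /\
  ex_derive (Derive (fun y => sin (u y t))) x /\
  Derive (fun y => Derive (fun s => u y s) t) x
    = sin (u x t) - Derive_n (fun y => sin (u y t)) 2 x.

Definition second_order_ode_at (c : R) (phi : R -> R) (x : R) : Prop :=
  (cos (phi x) - c) * Derive_n phi 2 x
    = sin (phi x) + (Derive phi x) ^ 2 * sin (phi x).

(** The integrated equation with [b = |c - 1|]; the first conjunct says that
    the quotient is meaningful. *)
Definition first_order_ode_at (c : R) (phi : R -> R) (x : R) : Prop :=
  c - cos (phi x) <> 0 /\
  (Derive phi x) ^ 2
    = ((c - 1) ^ 2 - (c - cos (phi x)) ^ 2) / (c - cos (phi x)) ^ 2.

Definition travelling_wave (c : R) (phi : R -> R) : R -> R -> R :=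
  fun x t => phi (x - c * t).

Definition wave_solution_off (c : R) (phi : R -> R) (xc : R) : Prop :=
  (forall x : R, continuous phi x) /\
  smooth_on (fun x => x <> xc) phi /\
  (forall x : R, x <> xc ->
     second_order_ode_at c phi x /\ first_order_ode_at c phi x) /\
  (forall x t : R, 0 < t -> x - c * t <> xc ->
     pde_at (travelling_wave c phi) x t).

Definition cusped_wave (c : R) (phi : R -> R) (xc : R) : Prop :=
  wave_solution_off c phi xc /\ has_cusp phi xc.

Definition anticusped_wave (c : R) (phi : R -> R) (xc : R) : Prop :=
  wave_solution_off c phi xc /\ has_anticusp phi xc.

Definition is_max_at (f : R -> R) (x0 M : R) : Prop :=
  f x0 = M /\ forall x : R, f x <= M.

Definition is_min_at (f : R -> R) (x0 m : R) : Prop :=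
  f x0 = m /\ forall x : R, m <= f x.

Definition range (f : R -> R) : R -> Prop := fun y => exists x : R, y = f x.

(** [f = O(g)] as [x -> x0].  The neighbourhood is punctured because
    [Rpower 0 a] is [1], not [0]. *)
Definition bigO_at (x0 : R) (f g : R -> R) : Prop :=
  exists C : R, locally' x0 (fun x => Rabs (f x) <= C * Rabs (g x)).

Definition sqrt_asymptotics (c : R) (phi : R -> R) (xc phi0 : R) : Prop :=
  bigO_at xc
    (fun x => Rabs (phi x - phi0)
       - sqrt 2 * Rpower ((1 - c) / (1 + c)) (1 / 4) * sqrt (Rabs (x - xc)))
    (fun x => x - xc).

Definition cbrt_asymptotics (phi : R -> R) (xc phi0 : R) : Prop :=
  bigO_at xc
    (fun x => Rabs (phi x - phi0)
       - Rpower 12 (1 / 3) * Rpower (Rabs (x - xc)) (1 / 3))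
    (fun x => Rpower (Rabs (x - xc)) (2 / 3)).

(* Main.v *)
Require Import Defs.
From Stdlib Require Import Reals ZArith.
From Coquelicot Require Import Coquelicot.
From Stdlib Require Import Lra Psatz Ranalysis5 IndefiniteDescription.
Open Scope R_scope.

(** On the half-line to the right of the crest, placed at [0], a profile that
    decreases from [acos c] to [0] solves the separable equation
    [dx = - slowness c phi dphi], where
    [slowness c s = (cos s - c) / sqrt ((1-c)^2 - (cos s - c)^2)].  Hence the
    profile is obtained by inverting the integral of [slowness], which vanishes
    at the crest and diverges logarithmically at [0] because
    [slowness c s ~ sqrt (1-c) / s]; it is then reflected evenly in [x], and
    up to sign and a shift by [2 n PI] this gives all the waves.  Away from
    the crest, [phi] is smooth since [phi'' = sin phi (1 + phi'^2) / (cos phi - c)]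
    makes the algebra generated by [phi], [phi'], [sin phi], [cos phi] and
    [1 / (cos phi - c)] stable under derivation.  At the crest [slowness]
    vanishes, so [phi'] blows up; it vanishes there to first order in the
    amplitude drop [y] if [-1 < c], to second order if [c = -1], so
    [x ~ K y^2 / 2] or [x ~ y^3 / 12], whence the square and cube root laws. *)

(** * Smoothness and the wave equation from the profile equation *)

(** Near a point of [D], [Derive_n F (k + 1)] agrees with [Derive_n F' k], and [F'] lies in [S]
    again, so the induction on [k] runs over all of [S] at once. Openness of [D] supplies the
    neighbourhoods. *)
Lemma smooth_of_differentially_closed
  (D : R -> Prop) (S : (R -> R) -> Prop) :
  open D ->
  (forall F, S F -> exists F', S F' /\ forall x, D x -> is_derive F x (F' x)) ->
  forall F, S F -> smooth_on D F.
Proof.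
  intros HD HS F SF k; revert F SF.
  assert (H : forall k F, S F -> forall x, D x -> ex_derive (Derive_n F k) x).
  { clear k; induction k as [|k IH]; intros F SF x Dx;
      destruct (HS F SF) as [F' [SF' dF]].
    - exists (F' x); apply dF, Dx.
    - apply ex_derive_ext_loc with (Derive_n F' k); [|now apply IH].
      generalize (HD x Dx); apply filter_imp; intros y Dy.
      change (Derive_n F (Datatypes.S k) y) with (Derive (Derive_n F k) y).
      replace (Derive (Derive_n F k) y) with (Derive_n F (k + 1) y)
        by now rewrite Nat.add_1_r.
      rewrite <- (Derive_n_comp F k 1 y).
      apply Derive_n_ext_loc.
      generalize (HD y Dy); apply filter_imp; intros z Dz.
      symmetry; apply is_derive_unique, dF, Dz. }
  destruct k as [|k]; intros F SF x Dx; [exact I|now apply H].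
Qed.

(** A predicate on functions, so that closure under derivation is an induction on membership; [p]
    stands for the derivative of [f]. *)
Inductive jet (c : R) (f p : R -> R) : (R -> R) -> Prop :=
| jet_val : jet c f p f
| jet_deriv : jet c f p p
| jet_sin : jet c f p (fun x => sin (f x))
| jet_cos : jet c f p (fun x => cos (f x))
| jet_inv : jet c f p (fun x => / (cos (f x) - c))
| jet_const a : jet c f p (fun _ => a)
| jet_plus F G : jet c f p F -> jet c f p G -> jet c f p (fun x => F x + G x)
| jet_mult F G : jet c f p F -> jet c f p G -> jet c f p (fun x => F x * G x).

Lemma smooth_of_ode (c : R) (D : R -> Prop) (f p : R -> R) :
  open D ->
  (forall x, D x -> cos (f x) - c <> 0) ->
  (forall x, D x -> is_derive f x (p x)) ->
  (forall x, D x ->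
     is_derive p x (sin (f x) * (1 + p x * p x) * / (cos (f x) - c))) ->
  smooth_on D f.
Proof.
  intros HD Hw df dp.
  apply smooth_of_differentially_closed with (S := jet c f p);
    [exact HD| |constructor].
  assert (ex : forall x, D x -> ex_derive f x) by (intros; eexists; eauto).
  assert (Df : forall x, D x -> Derive f x = p x)
    by (intros; now apply is_derive_unique, df).
  induction 1 as [| | | | |a|F G _ [F' [JF dF]] _ [G' [JG dG]]
                  |F G JF [F' [JF' dF]] JG [G' [JG' dG]]].
  - exists p; split; [constructor|exact df].
  - eexists; split; [|exact dp]; repeat constructor.
  - exists (fun x => cos (f x) * p x); split; [repeat constructor|].
    intros x Dx; auto_derive; [now auto|]; rewrite Df by trivial; ring.
  - exists (fun x => (-1) * (sin (f x) * p x)); split; [repeat constructor|].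
    intros x Dx; auto_derive; [now auto|]; rewrite Df by trivial; ring.
  - exists (fun x => sin (f x) * p x
              * (/ (cos (f x) - c) * / (cos (f x) - c)));
      split; [repeat constructor|].
    intros x Dx; specialize (Hw x Dx); auto_derive; [now auto|].
    rewrite Df by trivial; now field.
  - exists (fun _ => 0); split; [constructor|].
    intros x _; apply (is_derive_const a x).
  - exists (fun x => F' x + G' x); split; [now constructor|].
    intros x Dx; apply (is_derive_plus F G); auto.
  - exists (fun x => F' x * G x + F x * G' x); split; [repeat constructor; trivial|].
    intros x Dx; apply (is_derive_mult F G); auto.
    intros; apply Rmult_comm.
Qed.

(** For [u = f (x - c t)] one has [u_tx = - c f''] and [(sin u)_xx = cos f f'' - sin f f'^2], so the
    wave equation is the second-order profile equation rearranged. Off [xc], [Derive f] is replaced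
    locally by [p] before differentiating again. *)
Lemma wave_solution_of_profile (c xc : R) (f p : R -> R) :
  (forall x, continuous f x) ->
  (forall x, x <> xc -> cos (f x) - c <> 0) ->
  (forall x, x <> xc -> is_derive f x (p x)) ->
  (forall x, x <> xc ->
     is_derive p x (sin (f x) * (1 + p x * p x) * / (cos (f x) - c))) ->
  (forall x, x <> xc ->
     (p x) ^ 2 = ((c - 1) ^ 2 - (c - cos (f x)) ^ 2) / (c - cos (f x)) ^ 2) ->
  wave_solution_off c f xc.
Proof.
  intros Cf Hw df dp Hp.
  assert (Df : forall x, x <> xc -> Derive f x = p x)
    by (intros; now apply is_derive_unique, df).
  assert (Hloc : forall x, x <> xc -> locally x (fun y => y <> xc))
    by (intros; now apply open_neq).
  assert (Df2 : forall x, x <> xc ->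
            Derive_n f 2 x = sin (f x) * (1 + p x * p x) * / (cos (f x) - c)).
  { intros x Hx; apply is_derive_unique.
    apply is_derive_ext_loc with p; [|now apply dp].
    generalize (Hloc x Hx); apply filter_imp; intros y Hy; symmetry.
    now apply Df. }
  split; [exact Cf|split; [|split]].
  - apply smooth_of_ode with c p; trivial; apply open_neq.
  - intros x Hx; specialize (Hw x Hx); unfold second_order_ode_at, first_order_ode_at.
    rewrite (Df2 x Hx), (Df x Hx); repeat split.
    + now field.
    + lra.
    + now apply Hp.
  - intros x t _ Hx; unfold pde_at, travelling_wave.
    assert (Hlocx : locally x (fun y => y - c * t <> xc)).
    { apply (filter_imp (fun y => y <> xc + c * t));
        [intros y Hy ?; apply Hy; lra|apply open_neq; lra]. }
    assert (dt : forall y, y - c * t <> xc ->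
              is_derive (fun s => f (y - c * s)) t (- c * p (y - c * t))).
    { intros y Hy; auto_derive; [now exists (p (y - c * t)); apply df|].
      change (y + - (c * t)) with (y - c * t); rewrite Df by trivial; ring. }
    assert (dS : forall y, y - c * t <> xc ->
              is_derive (fun z => sin (f (z - c * t))) y
                (cos (f (y - c * t)) * p (y - c * t))).
    { intros y Hy; auto_derive; [now exists (p (y - c * t)); apply df|].
      change (y + - (c * t)) with (y - c * t); rewrite Df by trivial; ring. }
    set (z := x - c * t) in *.
    set (p' := sin (f z) * (1 + p z * p z) * / (cos (f z) - c)).
    assert (dP : is_derive p z p') by now apply dp.
    assert (Dp : Derive (fun y : R => p y) z = p') by now apply is_derive_unique.
    assert (dtx : is_derive (fun y => Derive (fun s => f (y - c * s)) t) x (- c * p')).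
    { apply is_derive_ext_loc with (fun y => - c * p (y - c * t)).
      - generalize Hlocx; apply filter_imp; intros y Hy; symmetry.
        now apply is_derive_unique, dt.
      - auto_derive; change (x + - (c * t)) with z; [now exists p'|].
        rewrite Dp; ring. }
    assert (dSS : is_derive (Derive (fun y => sin (f (y - c * t)))) x
              (cos (f z) * p' - sin (f z) * p z * p z)).
    { apply is_derive_ext_loc with (fun y => cos (f (y - c * t)) * p (y - c * t)).
      - generalize Hlocx; apply filter_imp; intros y Hy; symmetry.
        now apply is_derive_unique, dS.
      - auto_derive; change (x + - (c * t)) with z.
        + split; [exists (p z); now apply df|split; [now exists p'|exact I]].
        + rewrite Dp, Df by trivial; ring. }
    split; [|split; [|split; [|split]]].
    + generalize Hlocx; apply filter_imp; intros y Hy; eexists; now apply dt.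
    + eexists; exact dtx.
    + generalize Hlocx; apply filter_imp; intros y Hy; eexists; now apply dS.
    + eexists; exact dSS.
    + transitivity (- c * p'); [exact (is_derive_unique _ _ _ dtx)|].
      replace (Derive_n (fun y => sin (f (y - c * t))) 2 x)
        with (cos (f z) * p' - sin (f z) * p z * p z)
        by (symmetry; exact (is_derive_unique _ _ _ dSS)).
      fold z; unfold p'; specialize (Hw z Hx); now field.
Qed.

(** * Inversion of the travel integral *)

(** Positivity of [g] makes [G] strictly increasing, and unboundedness makes it onto the half-line.
    The margin [d] below 0 avoids one-sided derivatives; the inverse is differentiated only at
    [x > 0] because [g] may vanish at 0. *)
Lemma increasing_inverse (G g : R -> R) (d A : R) :
  0 < d -> 0 < A -> G 0 = 0 ->
  (forall y, - d < y < A -> is_derive G y (g y)) ->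
  (forall y, 0 < y < A -> 0 < g y) ->
  (forall M, exists y, 0 < y < A /\ M < G y) ->
  (forall y1 y2, 0 <= y1 -> y1 < y2 -> y2 < A -> G y1 < G y2) /\
  exists Y : R -> R,
    (forall x, 0 <= x -> 0 <= Y x < A /\ G (Y x) = x) /\
    (forall x, 0 < x -> is_derive Y x (/ g (Y x))).
Proof.
  intros Hd HA G0 dG gpos Gunb.
  assert (dG' : forall y, - d < y < A -> derivable_pt_lim G y (g y))
    by (intros; now apply is_derive_Reals, dG).
  assert (cG : forall y, - d < y < A -> continuity_pt G y)
    by (intros y Hy; apply derivable_continuous_pt; exists (g y); now apply dG').
  assert (Gincr : forall y1 y2, 0 <= y1 -> y1 < y2 -> y2 < A -> G y1 < G y2).
  { intros y1 y2 H1 H12 H2.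
    destruct (MVT_cor2 G g y1 y2 H12) as [z [Hz Iz]];
      [intros; apply dG'; lra|].
    assert (0 < g z) by (apply gpos; lra); nra. }
  split; [exact Gincr|].
  (* The guard [0 <= x] makes the relation total; for [x <= 0] the witness 0 works because
     [G 0 = 0]. *)
  destruct (functional_choice (fun x y => 0 <= x -> 0 <= y < A /\ G y = x))
    as [Y HY].
  { intros x; destruct (Rle_lt_dec x 0) as [Hx|Hx].
    { exists 0; intros; split; [lra|rewrite G0; lra]. }
    destruct (Gunb x) as [y1 [Hy1 Gy1]].
    destruct (IVT_interv (fun y => G y - x) 0 y1) as [z [Hz Gz]].
    - intros y Hy; apply continuity_pt_minus; [apply cG; lra|].
      apply continuity_pt_const; now intros ? ?.
    - lra.
    - rewrite G0; lra.
    - lra.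
    - exists z; intros; split; lra. }
  exists Y; split; [exact HY|].
  assert (Yincr : forall x1 x2, 0 <= x1 -> x1 <= x2 -> Y x1 <= Y x2).
  { intros x1 x2 H1 H2; destruct (HY x1), (HY x2); try lra.
    destruct (Rle_lt_dec (Y x1) (Y x2)); trivial.
    assert (G (Y x2) < G (Y x1)) by (apply Gincr; lra); lra. }
  intros x Hx; apply is_derive_Reals.
  assert (cY : continuity_pt Y x).
  { destruct (HY (x + 1)) as [HB GB]; [lra|].
    assert (0 < Y (x + 1)).
    { destruct (Rlt_le_dec 0 (Y (x + 1))) as [|H]; trivial.
      replace (Y (x + 1)) with 0 in GB by lra; lra. }
    apply (continuity_pt_recip_interv G Y 0 (Y (x + 1))); trivial.
    - intros; apply Gincr; lra.
    - intros z; rewrite G0, GB; intros; now apply HY.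
    - intros z; rewrite G0, GB; intros.
      split; [apply HY; lra|apply Yincr; lra].
    - intros; apply cG; lra.
    - rewrite G0, GB; lra. }
  assert (Prf : forall a, Y (x / 2) <= a <= Y (x + 1) -> - d < a < A).
  { intros a Ha; destruct (HY (x / 2)), (HY (x + 1)); lra. }
  assert (Hgx : Y (x / 2) <= Y x <= Y (x + 1)) by (split; apply Yincr; lra).
  assert (gx : 0 < g (Y x)).
  { apply gpos; destruct (HY x) as [H1 H2]; [lra|].
    destruct (Req_dec (Y x) 0) as [H|H]; [rewrite H in H2; lra|lra]. }
  replace (/ g (Y x)) with (1 / g (Y x)) by (field; lra).
  exact (derivable_pt_lim_recip_interv G Y (x / 2) (x + 1) x
           (fun a Ha => exist _ (g a) (dG' a (Prf a Ha))) cY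
           ltac:(lra) ltac:(lra) Hgx
           (fun z Hz => proj2 (HY z ltac:(lra))) (Rgt_not_eq _ _ gx)).
Qed.

(** * The slowness and its integral from the crest *)

Definition radicand (c s : R) : R := (1 - c) ^ 2 - (cos s - c) ^ 2.

(** [|dx/dphi|] along the profile; it is [0] at [s = 0], where Rocq's division by
    [sqrt 0] hides the singularity. *)
Definition slowness (c s : R) : R := (cos s - c) / sqrt (radicand c s).

(** The distance from the crest at which the profile has dropped by [y]. *)
Definition travel (c y : R) : R := RInt (fun t => slowness c (acos c - t)) 0 y.

Lemma acos_gt_0 (c : R) : -1 <= c < 1 -> 0 < acos c.
Proof.
  intros Hc; destruct (Req_dec c (-1)) as [->|].
  - replace (-1) with (- (1)) by ring; rewrite acos_opp, acos_1.
    pose proof PI_RGT_0; lra.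
  - apply acos_bound_lt; lra.
Qed.

Lemma cos_between_0_acos (c s : R) :
  -1 <= c < 1 -> 0 < s < acos c -> c < cos s < 1.
Proof.
  intros Hc Hs; pose proof (acos_bound c).
  rewrite <- (cos_acos c) at 1 by lra; rewrite <- cos_0.
  split; apply cos_decreasing_1; lra.
Qed.

Lemma radicand_pos (c s : R) :
  -1 <= c < 1 -> 0 < s <= acos c -> 0 < radicand c s.
Proof.
  intros Hc Hs; unfold radicand.
  destruct (Req_dec s (acos c)) as [->|].
  - rewrite cos_acos by lra; nra.
  - destruct (cos_between_0_acos c s Hc); [lra|nra].
Qed.

Lemma slowness_pos (c s : R) :
  -1 <= c < 1 -> 0 < s < acos c -> 0 < slowness c s.
Proof.
  intros Hc Hs; destruct (cos_between_0_acos c s Hc Hs).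
  apply Rdiv_lt_0_compat; [lra|].
  apply sqrt_lt_R0, radicand_pos; lra.
Qed.

Lemma continuous_slowness (c s : R) :
  0 < radicand c s -> continuous (slowness c) s.
Proof.
  intros Hr; apply @ex_derive_continuous; unfold slowness, radicand; auto_derive.
  split; [exact Hr|split; [|trivial]].
  now apply Rgt_not_eq, sqrt_lt_R0.
Qed.

(** Continuity pushes positivity slightly past the crest, that is to [y < 0], so that [travel] is
    differentiable on both sides of the crest, as [increasing_inverse] expects. *)
Lemma radicand_pos_near_crest (c : R) : -1 <= c < 1 ->
  exists d, 0 < d /\ forall y, - d < y < acos c -> 0 < radicand c (acos c - y).
Proof.
  intros Hc; pose proof (acos_gt_0 c Hc).
  assert (C : continuous (fun y => radicand c (acos c - y)) 0).
  { apply @ex_derive_continuous; unfold radicand; auto_derive; trivial. }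
  destruct (C (fun z => 0 < z)) as [d Hd].
  { apply open_gt; apply radicand_pos; lra. }
  exists d; split; [apply cond_pos|]; intros y Hy.
  destruct (Rle_lt_dec 0 y); [apply radicand_pos; lra|].
  apply (Hd y); unfold ball; simpl; unfold AbsRing_ball, abs, minus, plus, opp; simpl.
  apply Rabs_def1; lra.
Qed.

Lemma is_derive_travel (c : R) : -1 <= c < 1 ->
  exists d, 0 < d /\ forall y, - d < y < acos c ->
    is_derive (travel c) y (slowness c (acos c - y)).
Proof.
  intros Hc; pose proof (acos_gt_0 c Hc).
  destruct (radicand_pos_near_crest c Hc) as [d [Hd Hr]].
  assert (C : forall y, - d < y < acos c ->
            continuous (fun t => slowness c (acos c - t)) y).
  { intros y Hy; specialize (Hr y Hy).
    apply (continuous_comp (fun t => acos c - t) (slowness c)).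
    - apply @ex_derive_continuous; auto_derive; trivial.
    - now apply continuous_slowness. }
  exists d; split; [exact Hd|]; intros y Hy.
  apply (is_derive_RInt (fun t => slowness c (acos c - t)) (travel c) 0 y);
    [|now apply C].
  apply (locally_interval _ y (- d) (acos c)); simpl; try tauto.
  intros z H1 H2; apply (RInt_correct (fun t => slowness c (acos c - t))).
  apply @ex_RInt_continuous; intros t Ht.
  apply C; split.
  - apply Rlt_le_trans with (2 := proj1 Ht); apply Rmin_glb_lt; lra.
  - apply Rle_lt_trans with (1 := proj2 Ht); apply Rmax_lub_lt; lra.
Qed.

Lemma travel_0 (c : R) : travel c 0 = 0.
Proof. exact (RInt_point _ _). Qed.

Lemma Rabs_sin_le (x : R) : Rabs (sin x) <= Rabs x.
Proof.
  assert (H : forall y, 0 <= y -> - y <= sin y <= y).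
  { intros y Hy; split.
    - destruct (Rle_lt_dec y 1) as [|H]; [|pose proof (SIN_bound y); lra].
      pose proof PI_RGT_0; pose proof PI2_1.
      assert (0 <= sin y) by (apply sin_ge_0; lra); lra.
    - destruct (Rle_lt_or_eq_dec 0 y Hy) as [H|<-]; [|rewrite sin_0; lra].
      left; now apply sin_lt_x. }
  destruct (Rle_lt_dec 0 x).
  - rewrite (Rabs_right x) by lra; apply Rabs_le, H; lra.
  - rewrite (Rabs_left x), <- Rabs_Ropp, <- sin_neg by lra; apply Rabs_le, H; lra.
Qed.

Lemma cos_lower_bound (s : R) : 1 - s ^ 2 / 2 <= cos s.
Proof.
  replace (cos s) with (cos (2 * (s / 2))) by (f_equal; field).
  rewrite cos_2a_sin.
  assert (H := Rsqr_le_abs_1 _ _ (Rabs_sin_le (s / 2))); unfold Rsqr in H; nra.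
Qed.

(** The numerator is at least [1 - c - s^2] and the square root at most [sqrt (1 - c) s]. The term
    in [1 / s] makes [travel] diverge; the other stays bounded. *)
Lemma slowness_lower_bound (c s : R) : -1 <= c < 1 -> 0 < s <= acos c ->
  sqrt (1 - c) / s - s / sqrt (1 - c) <= slowness c s.
Proof.
  intros Hc Hs.
  set (r := sqrt (1 - c)).
  assert (Hr : 0 < r) by (apply sqrt_lt_R0; lra).
  assert (Hr2 : r * r = 1 - c) by (apply sqrt_sqrt; lra).
  set (q := sqrt (radicand c s)).
  assert (Hrad : 0 < radicand c s) by now apply radicand_pos.
  assert (Hq : 0 < q) by now apply sqrt_lt_R0.
  assert (Hq2 : q * q = radicand c s) by (apply sqrt_sqrt; lra).
  pose proof (cos_lower_bound s) as Hcos; pose proof (COS_bound s).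
  assert (Hw : 0 <= cos s - c).
  { destruct (Req_dec s (acos c)) as [->|].
    - rewrite cos_acos by lra; lra.
    - destruct (cos_between_0_acos c s Hc); lra. }
  assert (q <= r * s).
  { apply Rsqr_incr_0; unfold Rsqr; [|lra|nra].
    rewrite Hq2; unfold radicand.
    replace (r * s * (r * s)) with ((1 - c) * s ^ 2) by (rewrite <- Hr2; ring).
    (* With [e = 1 - cos s], the radicand is [2 (1 - c) e - e^2], and [e <= s^2 / 2]. *)
    assert (0 <= (1 - cos s) * (1 - cos s)) by nra.
    nra. }
  apply Rle_trans with ((cos s - c) / (r * s)).
  - apply Rle_trans with ((1 - c - s ^ 2) / (r * s)).
    + right; rewrite <- Hr2; field; lra.
    + apply Rmult_le_compat_r; [left; apply Rinv_0_lt_compat; nra|nra].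
  - unfold slowness; fold q; apply Rmult_le_compat_l; [trivial|].
    apply Rinv_le_contravar; lra.
Qed.

Lemma travel_unbounded (c : R) : -1 <= c < 1 ->
  forall M, exists y, 0 < y < acos c /\ M < travel c y.
Proof.
  intros Hc M; pose proof (acos_gt_0 c Hc) as HA; set (A := acos c) in *.
  set (r := sqrt (1 - c)).
  assert (Hr : 0 < r) by (apply sqrt_lt_R0; lra).
  destruct (is_derive_travel c Hc) as [d [Hd dT]]; fold A in dT.
  (* The primitive, vanishing at 0, of the lower bound for the slowness at [s = A - y], its
     subtracted term [s / r] being enlarged to [A / r]. It diverges logarithmically at [A]. *)
  set (L := fun y => r * (ln A - ln (A - y)) - A * y / r).
  assert (HL : forall y, 0 < y < A -> L y <= travel c y).
  { intros y Hy.
    destruct (MVT_cor2 (fun y => travel c y - L y)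
      (fun y => slowness c (A - y) - (r / (A - y) - A / r)) 0 y) as [z [Hz Iz]].
    - lra.
    - intros z Hz; apply is_derive_Reals.
      apply (is_derive_minus (travel c) L); [apply dT; lra|].
      unfold L; auto_derive; [lra|field; lra].
    - assert (H := slowness_lower_bound c (A - z) Hc); fold A r in H.
      assert (r / (A - z) - A / r <= slowness c (A - z)).
      { apply Rle_trans with (2 := H ltac:(lra)).
        apply Rplus_le_compat_l, Ropp_le_contravar, Rmult_le_compat_r; [|lra].
        left; now apply Rinv_0_lt_compat. }
      assert (L 0 = 0) by (unfold L; rewrite Rminus_0_r; field; lra).
      rewrite travel_0 in Hz; nra. }
  (* This gives [r (ln A - ln e) >= M + 1 + A^2 / r], whose last term pays for [A y / r] in [L]; the
     cap [A / 2] keeps [A - e] positive. *)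
  set (e := Rmin (A / 2) (exp (ln A - (M + 1 + A * A / r) / r))).
  assert (He : 0 < e) by (apply Rmin_glb_lt; [lra|apply exp_pos]).
  assert (e <= A / 2) by apply Rmin_l.
  exists (A - e); split; [lra|].
  apply Rlt_le_trans with (2 := HL (A - e) ltac:(lra)); unfold L.
  replace (A - (A - e)) with e by ring.
  assert (Hln : ln e <= ln A - (M + 1 + A * A / r) / r).
  { rewrite <- ln_exp; apply ln_le; [trivial|apply Rmin_r]. }
  assert (A * (A - e) / r <= A * A / r).
  { apply Rmult_le_compat_r; [left; now apply Rinv_0_lt_compat|nra]. }
  assert (r * ((M + 1 + A * A / r) / r) = M + 1 + A * A / r) by (field; lra).
  nra.
Qed.

(** * The wave profile *)

(** The profile is [A - Y |x|], with [Y] inverse to [travel]. The implicit relation between [f x]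
    and [|x|] is kept among the conclusions because the expansion at the crest is read off from
    it. *)
Lemma exists_profile (c : R) : -1 <= c < 1 -> exists f : R -> R,
  f 0 = acos c /\
  (forall x, 0 < f x <= acos c) /\
  (forall x, x <> 0 -> f x < acos c) /\
  (forall x, travel c (acos c - f x) = Rabs x) /\
  (forall x, x <> 0 -> is_derive f x (- sign x * / slowness c (f x))) /\
  (forall x, continuous f x) /\
  (forall e, 0 < e -> exists M, 0 < M /\ forall x, M < Rabs x -> f x < e).
Proof.
  intros Hc; pose proof (acos_gt_0 c Hc) as HA; set (A := acos c) in *.
  destruct (is_derive_travel c Hc) as [d [Hd dT]]; fold A in dT.
  destruct (increasing_inverse (travel c) (fun y => slowness c (A - y)) d A)
    as [Tincr [Y [HY dY]]]; trivial.
  { apply travel_0. }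
  { intros y Hy; apply slowness_pos; fold A; lra. }
  { exact (travel_unbounded c Hc). }
  assert (Ypos : forall x, 0 < x -> 0 < Y x).
  { intros x Hx; destruct (HY x) as [H1 H2]; [lra|].
    destruct (Req_dec (Y x) 0) as [H|]; [|lra].
    rewrite H, travel_0 in H2; lra. }
  assert (HY0 : Y 0 = 0).
  { destruct (HY 0) as [H1 H2]; [lra|].
    destruct (Req_dec (Y 0) 0) as [|H]; trivial.
    assert (H3 := Tincr 0 (Y 0)); rewrite travel_0 in H3; lra. }
  pose (f := fun x => A - Y (Rabs x)).
  assert (df : forall x, x <> 0 -> is_derive f x (- sign x * / slowness c (f x))).
  { intros x Hx; unfold f.
    assert (H1 := is_derive_comp Y Rabs x _ _ (dY _ (Rabs_pos_lt x Hx))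
                    (is_derive_Rabs (fun x => x) x 1 (is_derive_id x) Hx)).
    assert (H2 := is_derive_minus (fun _ => A) (fun x => Y (Rabs x)) x _ _
                    (is_derive_const A x) H1).
    match type of H2 with is_derive _ _ ?l =>
      replace (- sign x * / slowness c (A - Y (Rabs x))) with l; [exact H2|] end.
    unfold minus, plus, opp, zero, scal, one; simpl; unfold mult; simpl; ring. }
  exists f; unfold f; split; [|split; [|split; [|split; [|split; [exact df|split]]]]].
  - rewrite Rabs_R0, HY0; ring.
  - intros x; destruct (HY (Rabs x) (Rabs_pos x)); lra.
  - intros x Hx; assert (H := Ypos _ (Rabs_pos_lt x Hx)); lra.
  - intros x; replace (A - (A - Y (Rabs x))) with (Y (Rabs x)) by ring.
    apply HY, Rabs_pos.
  - intros x; destruct (Req_dec x 0) as [->|Hx];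
      [|apply @ex_derive_continuous; eexists; now apply df].
    (* Continuity at the crest comes from monotonicity of [travel]: a drop of at least [y] requires
       [|x| >= travel c y]. *)
    apply filterlim_locally; intros e.
    set (y := Rmin e (A / 2)).
    assert (Hy : 0 < y) by (apply Rmin_glb_lt; [apply cond_pos|lra]).
    assert (y <= A / 2) by apply Rmin_r.
    assert (y <= e) by apply Rmin_l.
    assert (HT : 0 < travel c y) by (rewrite <- (travel_0 c); apply Tincr; lra).
    exists (mkposreal _ HT); intros x Hx.
    unfold ball in *; simpl in *; unfold AbsRing_ball, abs, minus, plus, opp in *;
      simpl in *.
    rewrite Ropp_0, Rplus_0_r in Hx; rewrite Rabs_R0, HY0.
    destruct (HY (Rabs x) (Rabs_pos x)) as [H1 H2].
    destruct (Rlt_le_dec (Y (Rabs x)) y) as [|H3].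
    + rewrite Rabs_left1; lra.
    + destruct H3 as [H3|H3]; [|rewrite H3 in Hx; lra].
      assert (H4 := Tincr y _ ltac:(lra) H3 ltac:(lra)); lra.
  - intros e He.
    set (y := Rmax (A - e) (A / 2)).
    assert (A - e <= y) by apply Rmax_l.
    assert (A / 2 <= y) by apply Rmax_r.
    assert (y < A) by (apply Rmax_lub_lt; lra).
    exists (travel c y); split; [rewrite <- (travel_0 c); apply Tincr; lra|].
    intros x Hx; destruct (HY (Rabs x) (Rabs_pos x)) as [HY1 HY2].
    destruct (Rlt_le_dec y (Y (Rabs x))) as [|H3]; [lra|].
    destruct H3 as [H3|H3]; [|rewrite <- H3 in Hx; lra].
    assert (H4 := Tincr (Y (Rabs x)) y ltac:(lra) H3 ltac:(lra)); lra.
Qed.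

(** With [w = cos s - c] and [q] the root of the radicand, [q q' = w sin s], and the quotient rule
    for [q / w] gives [sin s (1 + q^2 / w^2) / q]. The factor [1 + q^2 / w^2] becomes [1 + p^2] in
    the profile equation. *)
Lemma is_derive_inv_slowness (c s : R) : -1 <= c < 1 -> 0 < s < acos c ->
  is_derive (fun s => / slowness c s) s
    (sin s * (1 + / slowness c s * / slowness c s) * / sqrt (radicand c s)).
Proof.
  intros Hc Hs; destruct (cos_between_0_acos c s Hc Hs).
  assert (Hr : 0 < radicand c s) by (apply radicand_pos; lra).
  assert (Hq : 0 < sqrt (radicand c s)) by now apply sqrt_lt_R0.
  (* Valid for every [t], even where a denominator vanishes, because [/ 0 = 0]. *)
  assert (E : forall t, sqrt (radicand c t) / (cos t - c) = / slowness c t)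
    by (intros t; unfold slowness, Rdiv; rewrite Rinv_mult, Rinv_inv; ring).
  apply is_derive_ext with (1 := E).
  rewrite <- E; set (q := sqrt (radicand c s)) in *.
  assert (Hq2 : q * q = radicand c s) by (apply sqrt_sqrt; lra).
  unfold radicand; auto_derive.
  - split; [exact Hr|split; [lra|trivial]].
  - match goal with |- context [sqrt ?e] => change (sqrt e) with q end.
    field_simplify_eq; [|lra].
    nra.
Qed.

Lemma cos_sin_shift (n : Z) (x : R) :
  cos (2 * IZR n * PI + x) = cos x /\ sin (2 * IZR n * PI + x) = sin x.
Proof.
  assert (H : forall (k : nat) y, cos (2 * INR k * PI + y) = cos y /\
                            sin (2 * INR k * PI + y) = sin y).
  { intros k y; replace (2 * INR k * PI + y) with (y + 2 * INR k * PI) by ring.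
    split; [apply cos_period|apply sin_period]. }
  destruct (Z_le_gt_dec 0 n) as [Hn|Hn].
  - rewrite <- (Z2Nat.id n Hn), <- INR_IZR_INZ; apply H.
  - destruct (H (Z.to_nat (- n)) (2 * IZR n * PI + x)) as [H1 H2].
    rewrite INR_IZR_INZ, Z2Nat.id, opp_IZR in H1, H2 by lia.
    rewrite <- H1, <- H2; split; f_equal; ring.
Qed.

(** The slowness is continuous with value 0 at [acos c] and positive below it, so along [F] it tends
    to 0 from the right. A general filter covers both sides of the crest. *)
Lemma inv_slowness_blowup (c : R) (f : R -> R) (F : (R -> Prop) -> Prop)
  {FF : Filter F} :
  -1 <= c < 1 -> filterlim f F (locally (acos c)) ->
  F (fun x => 0 < f x < acos c) ->
  filterlim (fun x => / slowness c (f x)) F (Rbar_locally p_infty).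
Proof.
  intros Hc Hf HF.
  apply (filterlim_comp _ _ _ (fun x => slowness c (f x)) Rinv F (at_right 0));
    [|exact filterlim_Rinv_0_right].
  intros P HP; unfold filtermap.
  assert (S0 : slowness c (acos c) = 0).
  { unfold slowness; rewrite cos_acos by lra; unfold Rdiv; ring. }
  assert (HS : filterlim (fun x => slowness c (f x)) F (locally 0)).
  { rewrite <- S0; apply (filterlim_comp _ _ _ f (slowness c) F _ _ Hf).
    apply continuous_slowness, radicand_pos; trivial.
    pose proof (acos_gt_0 c Hc); lra. }
  assert (HP' : F (fun x => 0 < slowness c (f x) -> P (slowness c (f x))))
    by exact (HS _ HP).
  generalize (filter_and _ _ HF HP'); apply filter_imp.
  intros x [Hx H]; now apply H, slowness_pos.
Qed.

(** The profile equations are invariant under reflection and under shifts by [2 n PI], cosine being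
    even and sine odd: [s = 1] yields the cusp, [s = -1] the anticusp. *)
Lemma exists_wave (c : R) (n : Z) (s : R) : -1 <= c < 1 -> s = 1 \/ s = -1 ->
  exists phi : R -> R,
    wave_solution_off c phi 0 /\ has_cusp phi 0 /\
    is_lim phi p_infty (2 * IZR n * PI) /\
    is_lim phi m_infty (2 * IZR n * PI) /\
    phi 0 = 2 * IZR n * PI + s * acos c /\
    (forall x, 0 < s * (phi x - 2 * IZR n * PI) <= acos c) /\
    (forall x, x <> 0 -> s * (phi x - 2 * IZR n * PI) < acos c) /\
    (forall x, travel c (acos c - s * (phi x - 2 * IZR n * PI)) = Rabs x) /\
    (forall x, continuous phi x).
Proof.
  intros Hc Hs.
  assert (Hss : s * s = 1) by (destruct Hs; subst; ring).
  destruct (exists_profile c Hc) as [f [f0 [fpos [fA [fT [df [cf flim]]]]]]].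
  set (k := 2 * IZR n * PI).
  pose (phi := fun x => k + s * f x).
  pose (p := fun x => s * (- sign x * / slowness c (f x))).
  assert (Ef : forall x, s * (phi x - k) = f x).
  { intros x; unfold phi; transitivity ((s * s) * f x); [ring|rewrite Hss; ring]. }
  assert (Hcos : forall x, cos (phi x) = cos (f x)).
  { intros x; unfold phi, k; rewrite (proj1 (cos_sin_shift n _)).
    destruct Hs; subst s; [now rewrite Rmult_1_l|].
    replace (-1 * f x) with (- f x) by ring; apply cos_neg. }
  assert (Hsin : forall x, sin (phi x) = s * sin (f x)).
  { intros x; unfold phi, k; rewrite (proj2 (cos_sin_shift n _)).
    destruct Hs; subst s; [now rewrite !Rmult_1_l|].
    replace (-1 * f x) with (- f x) by ring; rewrite sin_neg; ring. }
  assert (cphi : forall x, continuous phi x).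
  { intros x; apply (continuous_plus (fun _ => k) (fun x => s * f x));
      [apply continuous_const|].
    apply (continuous_scal_r s f); apply cf. }
  assert (dphi : forall x, x <> 0 -> is_derive phi x (p x)).
  { intros x Hx; assert (H := df x Hx); unfold phi, p.
    auto_derive; [eexists; exact H|].
    rewrite (is_derive_unique (fun x : R => f x) x _ H); ring. }
  assert (Hw : forall x, x <> 0 -> c < cos (f x)).
  { intros x Hx; apply cos_between_0_acos; trivial; split; [apply fpos|now apply fA]. }
  assert (Hsign : forall x, x <> 0 -> (sign x * sign x = 1 /\
             locally x (fun y => sign y = sign x))).
  { intros x Hx; destruct (Rlt_le_dec 0 x) as [H|H].
    - rewrite (sign_eq_1 x H); split; [ring|].
      apply (filter_imp (fun y => 0 < y)); [apply sign_eq_1|now apply open_gt].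
    - assert (H' : x < 0) by lra; rewrite (sign_eq_m1 x H'); split; [ring|].
      apply (filter_imp (fun y => y < 0)); [apply sign_eq_m1|now apply open_lt]. }
  assert (Hclose : forall e x, f x < e -> Rabs (phi x - k) < e).
  { intros e x He; unfold phi; assert (H := fpos x).
    destruct Hs; subst s; apply Rabs_def1; lra. }
  assert (Hwave : wave_solution_off c phi 0).
  { apply wave_solution_of_profile with p; trivial.
    - intros x Hx; rewrite Hcos; specialize (Hw x Hx); lra.
    - intros x Hx; destruct (Hsign x Hx) as [Hsg Hloc].
      (* [sign] is constant near [x], so there [p] is a constant multiple of
         [/ slowness c (f y)]. *)
      apply is_derive_ext_loc with (fun y => - s * sign x * / slowness c (f y)).
      { assert (Ep : forall y, sign y = sign x ->
                  - s * sign x * / slowness c (f y) = p y)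
          by (intros y Hy; unfold p; rewrite Hy; ring).
        generalize Hloc; apply filter_imp; exact Ep. }
      assert (Hfx : 0 < f x < acos c) by (split; [apply fpos|now apply fA]).
      assert (H1 := is_derive_comp _ f x _ _
                      (is_derive_inv_slowness c (f x) Hc Hfx) (df x Hx)).
      assert (H2 := is_derive_scal _ x (- s * sign x) _ H1).
      match type of H2 with is_derive _ _ ?l =>
        replace (sin (phi x) * (1 + p x * p x) * / (cos (phi x) - c)) with l;
          [exact H2|] end.
      unfold scal; simpl; unfold mult; simpl.
      rewrite Hsin, Hcos; unfold p, slowness.
      assert (Hr : 0 < sqrt (radicand c (f x)))
        by (apply sqrt_lt_R0, radicand_pos; lra).
      specialize (Hw x Hx).
      replace (s * (- sign x * / ((cos (f x) - c) / sqrt (radicand c (f x)))) *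
               (s * (- sign x * / ((cos (f x) - c) / sqrt (radicand c (f x))))))
        with ((s * s) * (sign x * sign x) *
              (/ ((cos (f x) - c) / sqrt (radicand c (f x)))
               * / ((cos (f x) - c) / sqrt (radicand c (f x))))) by ring.
      rewrite Hss, Hsg.
      match goal with |- ?l = _ => replace l with
        (s * (sign x * sign x) * (sin (f x) * (1 +
            / ((cos (f x) - c) / sqrt (radicand c (f x))) *
            / ((cos (f x) - c) / sqrt (radicand c (f x))))
           * / sqrt (radicand c (f x)) * / ((cos (f x) - c) / sqrt (radicand c (f x)))))
        by ring end.
      rewrite Hsg; field; lra.
    - intros x Hx; rewrite Hcos; unfold p, slowness.
      assert (Hr : 0 < radicand c (f x)) by (apply radicand_pos; auto).
      assert (Hq : 0 < sqrt (radicand c (f x))) by now apply sqrt_lt_R0.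
      specialize (Hw x Hx); destruct (Hsign x Hx) as [Hsg _].
      transitivity ((s * s) * (sign x * sign x)
        * (sqrt (radicand c (f x)) * sqrt (radicand c (f x))) / (cos (f x) - c) ^ 2).
      { field; lra. }
      rewrite Hss, Hsg, sqrt_sqrt by lra; unfold radicand; field; lra. }
  exists phi; split; [|split; [|split; [|split; [|split; [|split; [|split; [|split]]]]]]].
  - exact Hwave.
  - assert (Dp : forall x, x <> 0 -> Derive phi x = p x)
      by (intros; now apply is_derive_unique, dphi).
    assert (Hsm := proj1 (proj2 Hwave)).
    split; [exact cphi|split].
    + exists 1; split; [lra|].
      split; intros m x Hx; apply Hsm; intros ->; lra.
    + assert (Hlim : forall F : (R -> Prop) -> Prop, Filter F ->
                filter_le F (locally 0) -> F (fun x => x <> 0) ->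
                filterlim (fun x => / slowness c (f x)) F (Rbar_locally p_infty)).
      { intros F FF HF HF0; apply inv_slowness_blowup; trivial.
        - rewrite <- f0; exact (filterlim_filter_le_1 _ HF (cf 0)).
        - generalize HF0; apply filter_imp; intros x Hx.
          split; [apply fpos|now apply fA]. }
      assert (Hr : filterlim (fun x => / slowness c (f x)) (at_right 0)
                (Rbar_locally p_infty)).
      { apply Hlim; [apply within_filter, locally_filter|apply filter_le_within|].
        exists (mkposreal 1 Rlt_0_1); intros x _ Hx ->; exact (Rlt_irrefl 0 Hx). }
      assert (Hl : filterlim (fun x => / slowness c (f x)) (at_left 0)
                (Rbar_locally p_infty)).
      { apply Hlim; [apply within_filter, locally_filter|apply filter_le_within|].
        exists (mkposreal 1 Rlt_0_1); intros x _ Hx ->; exact (Rlt_irrefl 0 Hx). }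
      assert (Er : forall x, 0 < x -> Derive phi x = - s * / slowness c (f x)).
      { intros x Hx; rewrite Dp by (intros ->; lra); unfold p.
        rewrite sign_eq_1 by trivial; ring. }
      assert (El : forall x, x < 0 -> Derive phi x = s * / slowness c (f x)).
      { intros x Hx; rewrite Dp by (intros ->; lra); unfold p.
        rewrite sign_eq_m1 by trivial; ring. }
      assert (Hopp : forall F : (R -> Prop) -> Prop,
                filterlim (fun x => / slowness c (f x)) F (Rbar_locally p_infty) ->
                filterlim (fun x => - / slowness c (f x)) F (Rbar_locally m_infty)).
      { intros F HF.
        exact (filterlim_comp _ _ _ _ _ _ _ _ HF (filterlim_Rbar_opp p_infty)). }
      (* The slope to the left of the crest has the sign of [s], which selects the disjunct of
         [has_cusp]. *)
      destruct Hs; [left|right]; subst s; split.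
      * apply filterlim_within_ext with (2 := Hl).
        intros x Hx; rewrite El by trivial; ring.
      * apply filterlim_within_ext with (2 := Hopp _ Hr).
        intros x Hx; rewrite Er by trivial; ring.
      * apply filterlim_within_ext with (2 := Hopp _ Hl).
        intros x Hx; rewrite El by trivial; ring.
      * apply filterlim_within_ext with (2 := Hr).
        intros x Hx; rewrite Er by trivial; ring.
  - apply is_lim_spec; intros e; destruct (flim e (cond_pos e)) as [M [HM H]].
    exists M; intros x Hx; apply Hclose, H.
    rewrite Rabs_right; lra.
  - apply is_lim_spec; intros e; destruct (flim e (cond_pos e)) as [M [HM H]].
    exists (- M); intros x Hx; apply Hclose, H.
    rewrite Rabs_left; lra.
  - unfold phi; now rewrite f0.
  - intros x; rewrite Ef; apply fpos.
  - intros x Hx; rewrite Ef; now apply fA.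
  - intros x; rewrite Ef; apply fT.
  - exact cphi.
Qed.

(** * Expansion at the crest *)

(** With [w = cos s - c], [b = 1 - c] and [q] the root, [b^2 - q^2 = w^2] turns the difference into
    [w^3 / (q b (b + q))]. Since [w <= b / 2] gives [q >= b / 2], the denominator is at least
    [b^3 / 2]. *)
Lemma slowness_approx (c s : R) : c < 1 -> 0 <= cos s - c <= (1 - c) / 2 ->
  Rabs (slowness c s - (cos s - c) / (1 - c)) <= 2 * (cos s - c) ^ 3 / (1 - c) ^ 3.
Proof.
  intros Hc; unfold slowness, radicand.
  set (w := cos s - c); set (b := 1 - c); intros Hw.
  assert (Hb : 0 < b) by (unfold b; lra).
  set (q := sqrt (b ^ 2 - w ^ 2)).
  assert (Hq2 : q * q = b ^ 2 - w ^ 2) by (apply sqrt_sqrt; nra).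
  assert (Hq0 : 0 <= q) by apply sqrt_pos.
  assert (Hq : b / 2 <= q) by (apply Rsqr_incr_0; unfold Rsqr; nra).
  assert (Hqb : q <= b) by (apply Rsqr_incr_0; unfold Rsqr; nra).
  replace (w / q - w / b) with (w ^ 3 / (q * b * (b + q))).
  2:{ replace (w ^ 3) with (w * (b ^ 2 - q * q)) by (rewrite Hq2; ring); field; lra. }
  rewrite Rabs_right.
  - replace (2 * w ^ 3 / b ^ 3) with (w ^ 3 * / (b / 2 * b * b)) by (field; lra).
    apply Rmult_le_compat_l; [apply pow_le; lra|].
    apply Rinv_le_contravar; [repeat apply Rmult_lt_0_compat; lra|].
    apply Rmult_le_compat; nra.
  - apply Rle_ge, Rmult_le_pos; [apply pow_le; lra|].
    left; apply Rinv_0_lt_compat; repeat apply Rmult_lt_0_compat; lra.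
Qed.

(** The slowness estimate is integrated by the mean value theorem: the error at some [z < y], times
    [y]. Only a factor [1 / (m + 2)] is lost. *)
Lemma travel_expansion (c a C t : R) (m : nat) : -1 <= c < 1 -> t <= acos c ->
  (forall z, 0 < z < t ->
     Rabs (slowness c (acos c - z) - a * z ^ m) <= C * z ^ (m + 1)) ->
  forall y, 0 < y < t ->
    Rabs (travel c y - a * y ^ (m + 1) / INR (m + 1)) <= C * y ^ (m + 2).
Proof.
  intros Hc Ht H y Hy.
  destruct (is_derive_travel c Hc) as [d [Hd dT]].
  assert (Hm : INR (m + 1) <> 0) by (apply not_0_INR; lia).
  destruct (MVT_cor2 (fun y => travel c y - a * y ^ (m + 1) / INR (m + 1))
      (fun y => slowness c (acos c - y) - a * y ^ m) 0 y) as [z [Ez Iz]].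
  - lra.
  - intros z Hz; apply is_derive_Reals.
    apply (is_derive_minus (travel c)); [apply dT; lra|].
    auto_derive; [trivial|].
    replace (Init.Nat.pred (m + 1)) with m by lia; now field.
  - rewrite travel_0, pow_i in Ez by lia.
    replace (travel c y - a * y ^ (m + 1) / INR (m + 1))
      with ((slowness c (acos c - z) - a * z ^ m) * (y - 0))
      by (rewrite <- Ez; now field).
    rewrite Rabs_mult, Rminus_0_r, (Rabs_right y) by lra.
    replace (m + 2)%nat with (S (m + 1)) by lia.
    replace (C * y ^ S (m + 1)) with (C * y ^ (m + 1) * y) by (simpl; ring).
    apply Rmult_le_compat_r; [lra|].
    apply Rle_trans with (1 := H z ltac:(lra)).
    apply Rmult_le_compat_l.
    (* The sign of [C] is read off from the estimate itself, which bounds an absolute value. *)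
    + assert (0 <= C * z ^ (m + 1))
        by (apply Rle_trans with (2 := H z ltac:(lra)), Rabs_pos).
      assert (0 < z ^ (m + 1)) by (apply pow_lt; lra); nra.
    + apply pow_incr; lra.
Qed.

Lemma sin_cubic_bounds (t : R) : 0 < t -> t - t ^ 3 / 2 <= sin t <= t.
Proof.
  intros Ht; split; [|left; now apply sin_lt_x].
  destruct (MVT_cor2 sin cos 0 t Ht) as [z [Ez Iz]];
    [intros; apply derivable_pt_lim_sin|].
  rewrite sin_0, !Rminus_0_r in Ez; pose proof (cos_lower_bound z).
  assert (z ^ 2 <= t ^ 2) by nra.
  assert ((1 - t ^ 2 / 2) * t <= cos z * t) by (apply Rmult_le_compat_r; lra).
  rewrite Ez; nra.
Qed.

(** [z] solves [x = K z^2 / 2]. Factoring [y^2 - z^2] and dividing by [y + z >= y] gives an error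
    [2 C y^2 / K]; the smallness of [C y] gives [y^2 <= 4 x / K], hence the constant [8 C / K^2]. *)
Lemma sqrt_expansion (K C x y z : R) : 0 < K -> 0 < y -> 0 <= z ->
  z * z = 2 * x / K -> C * y <= K / 4 ->
  Rabs (x - K * y ^ 2 / 2) <= C * y ^ 3 ->
  Rabs (y - z) <= 8 * C / K ^ 2 * x.
Proof.
  intros HK Hy Hz Ez HC H.
  assert (HC0 : 0 <= C).
  { assert (0 < y ^ 3) by (apply pow_lt; lra).
    pose proof (Rabs_pos (x - K * y ^ 2 / 2)); nra. }
  assert (Ex : x = K / 2 * (z * z)) by (rewrite Ez; field; lra).
  apply Rabs_le_between in H.
  assert (C * y ^ 3 <= K / 4 * y ^ 2) by nra.
  assert (Hx : K / 4 * y ^ 2 <= x) by lra.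
  assert (H1 : Rabs (y - z) <= 2 * C / K * y ^ 2).
  { apply Rmult_le_reg_r with (y + z); [lra|].
    rewrite <- (Rabs_right (y + z)) at 1 by lra; rewrite <- Rabs_mult.
    apply Rle_trans with (2 * C / K * y ^ 3).
    - replace ((y - z) * (y + z)) with (2 / K * (K * y ^ 2 / 2 - x))
        by (rewrite Ex; field; lra).
      rewrite Rabs_mult, (Rabs_right (2 / K)).
      2:{ apply Rle_ge, Rdiv_le_0_compat; lra. }
      replace (2 * C / K * y ^ 3) with (2 / K * (C * y ^ 3)) by (field; lra).
      apply Rmult_le_compat_l; [apply Rdiv_le_0_compat; lra|].
      apply Rabs_le; lra.
    - assert (0 <= 2 * C / K) by (apply Rdiv_le_0_compat; lra).
      assert (0 <= 2 * C / K * y ^ 2) by (apply Rmult_le_pos; nra).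
      nra. }
  apply Rle_trans with (1 := H1).
  replace (8 * C / K ^ 2 * x) with (2 * C / K * (4 / K * x)) by (field; lra).
  apply Rmult_le_compat_l; [apply Rdiv_le_0_compat; lra|].
  replace (y ^ 2) with (4 / K * (K / 4 * y ^ 2)) by (field; lra).
  apply Rmult_le_compat_l; [apply Rdiv_le_0_compat; lra|exact Hx].
Qed.

(** Here [z] and [v] are the cube roots of [12 x] and [x]. Factoring [y^3 - z^3] and dividing by the
    quadratic factor, at least [y^2], gives an error [12 C y^2]; then [y <= 3 v]. *)
Lemma cbrt_expansion (C x y z v : R) : 0 < y -> 0 < z -> 0 < v ->
  z ^ 3 = 12 * x -> v ^ 3 = x -> C * y <= 1 / 24 ->
  Rabs (x - y ^ 3 / 12) <= C * y ^ 4 ->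
  Rabs (y - z) <= 108 * C * v ^ 2.
Proof.
  intros Hy Hz Hv Ez Ev HC H.
  assert (Hy3 : 0 < y ^ 3) by (apply pow_lt; lra).
  assert (Hy4 : 0 < y ^ 4) by (apply pow_lt; lra).
  assert (HC0 : 0 <= C) by (pose proof (Rabs_pos (x - y ^ 3 / 12)); nra).
  assert (H1 : Rabs (y - z) <= 12 * C * y ^ 2).
  { apply Rmult_le_reg_r with (y ^ 2 + y * z + z ^ 2); [nra|].
    rewrite <- (Rabs_right (y ^ 2 + y * z + z ^ 2)) at 1 by nra.
    rewrite <- Rabs_mult.
    apply Rle_trans with (12 * C * y ^ 4).
    - replace ((y - z) * (y ^ 2 + y * z + z ^ 2)) with (- (12 * (x - y ^ 3 / 12)))
        by (replace x with (z ^ 3 / 12) by lra; field).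
      rewrite Rabs_Ropp, Rabs_mult, (Rabs_right 12) by lra; lra.
    - replace (12 * C * y ^ 4) with (12 * C * y ^ 2 * y ^ 2) by ring.
      apply Rmult_le_compat_l; nra. }
  apply Rabs_le_between in H.
  assert (C * y ^ 4 <= 1 / 24 * y ^ 3) by nra.
  (* The smallness of [C y] gives [y^3 <= 24 x]; 24 is rounded up to the cube 27. *)
  assert (y ^ 3 <= 27 * v ^ 3) by (rewrite Ev; lra).
  assert (y <= 3 * v).
  { destruct (Rle_lt_dec y (3 * v)) as [|L]; trivial.
    assert (0 < (y - 3 * v) * (y ^ 2 + 3 * v * y + 9 * v ^ 2))
      by (apply Rmult_lt_0_compat; nra).
    nra. }
  apply Rle_trans with (1 := H1).
  replace (108 * C * v ^ 2) with (12 * C * (3 * v) ^ 2) by ring.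
  apply Rmult_le_compat_l; [lra|]. apply pow_incr; lra.
Qed.

(** By the addition formula [w = cos (acos c - t) - c] is [sqrt (1 - c^2) t] up to [t^2], whence
    [1 / (1 - c)]. The other constant bounds [2 w^3 / (1 - c)^3] through [w <= 2 t];
    [t < (1 - c) / 4] puts [w] in the range of [slowness_approx]. *)
Lemma slowness_crest (c t : R) : -1 < c < 1 ->
  0 < t < Rmin (acos c) ((1 - c) / 4) ->
  Rabs (slowness c (acos c - t) - sqrt (1 - c ^ 2) / (1 - c) * t ^ 1)
    <= (1 / (1 - c) + 16 / (1 - c) ^ 3) * t ^ (1 + 1).
Proof.
  intros Hc [Ht0 Ht].
  assert (HtA := Rlt_le_trans _ _ _ Ht (Rmin_l _ _)).
  assert (Htb := Rlt_le_trans _ _ _ Ht (Rmin_r _ _)).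
  set (b := 1 - c) in *; assert (Hb : 0 < b < 2) by (unfold b; lra).
  destruct (cos_between_0_acos c (acos c - t)) as [Hw _]; [lra|lra|].
  assert (Ew : cos (acos c - t) = c * cos t + sqrt (1 - c ^ 2) * sin t).
  { rewrite cos_minus, cos_acos, sin_acos, Rsqr_pow2 by lra; ring. }
  assert (HS : 0 <= sqrt (1 - c ^ 2) <= 1).
  { split; [apply sqrt_pos|].
    rewrite <- sqrt_1 at 2; apply sqrt_le_1_alt; nra. }
  set (S := sqrt (1 - c ^ 2)) in *.
  pose proof (cos_lower_bound t); pose proof (COS_bound t).
  destruct (sin_cubic_bounds t Ht0).
  assert (t ^ 3 <= t ^ 2) by nra.
  assert (Hc1 : - (t ^ 2 / 2) <= c * (cos t - 1) <= t ^ 2 / 2) by (split; nra).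
  assert (Hs1 : - (t ^ 2 / 2) <= S * (sin t - t) <= 0) by (split; nra).
  set (w := cos (acos c - t) - c).
  assert (Hw1 : - t ^ 2 <= w - S * t <= t ^ 2) by (unfold w; rewrite Ew; lra).
  assert (Hw2 : 0 <= w <= 2 * t) by (unfold w in *; split; [lra|nra]).
  assert (Hap := slowness_approx c (acos c - t) ltac:(lra)); fold w b in Hap.
  specialize (Hap ltac:(lra)).
  assert (Hb3 : 0 < / b ^ 3) by (apply Rinv_0_lt_compat, pow_lt; lra).
  assert (Hb1 : 0 < / b) by (apply Rinv_0_lt_compat; lra).
  assert (Hcub : 2 * w ^ 3 / b ^ 3 <= 16 / b ^ 3 * t ^ 2).
  { assert (w ^ 3 <= (2 * t) ^ 3) by (apply pow_incr; lra).
    replace (16 / b ^ 3 * t ^ 2) with (16 * t ^ 2 * / b ^ 3)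
      by (unfold Rdiv; ring).
    apply Rmult_le_compat_r; nra. }
  assert (Hlin : - (1 / b * t ^ 2) <= w / b - S / b * t <= 1 / b * t ^ 2)
    by (unfold Rdiv; split; nra).
  apply Rabs_le_between in Hap; apply Rabs_le; simpl Nat.add.
  rewrite pow_1, Rmult_plus_distr_r; lra.
Qed.

(** For [c = -1] the linear coefficient vanishes and [1 - cos t] is [t^2 / 2] up to [t^4]. Errors in
    [t^4] and [t^6] are weakened to [t^3], the order used by [travel_expansion]. *)
Lemma slowness_crest_pi (t : R) : 0 < t < 1 ->
  Rabs (slowness (-1) (acos (-1) - t) - / 4 * t ^ 2) <= t ^ (2 + 1).
Proof.
  intros Ht.
  assert (Hpi : acos (-1) = PI).
  { replace (-1) with (- (1)) by ring; rewrite acos_opp, acos_1; ring. }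
  rewrite Hpi.
  assert (Ec : cos (PI - t) - -1 = 1 - cos t).
  { rewrite Rtrigo_facts.cos_pi_minus; ring. }
  assert (Hc : t ^ 2 / 2 - t ^ 4 / 8 <= 1 - cos t <= t ^ 2 / 2).
  { pose proof (cos_lower_bound t); split; [|lra].
    replace (cos t) with (cos (2 * (t / 2))) by (f_equal; field).
    rewrite cos_2a_sin; destruct (sin_cubic_bounds (t / 2)) as [H1 _]; [lra|].
    assert (0 <= t / 2 - (t / 2) ^ 3 / 2) by nra.
    assert ((t / 2 - (t / 2) ^ 3 / 2) ^ 2 <= sin (t / 2) ^ 2)
      by (apply pow_incr; lra).
    nra. }
  assert (H := slowness_approx (-1) (PI - t)).
  rewrite Ec in H; replace (1 - -1) with 2 in H by ring.
  assert (Hw0 : 0 <= 1 - cos t) by (pose proof (COS_bound t); lra).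
  specialize (H ltac:(lra) ltac:(nra)).
  assert (Hw3 : (1 - cos t) ^ 3 <= (t ^ 2 / 2) ^ 3) by (apply pow_incr; lra).
  assert (Ht3 : 0 < t ^ 3) by (apply pow_lt; lra).
  assert (Ht4 : t ^ 4 <= t ^ 3) by nra.
  assert (Ht6 : t ^ 6 <= t ^ 3) by (replace (t ^ 6) with (t ^ 3 * t ^ 3) by ring; nra).
  replace ((t ^ 2 / 2) ^ 3) with (t ^ 6 / 8) in Hw3 by field.
  apply Rabs_le_between in H; apply Rabs_le; simpl Nat.add; lra.
Qed.

(** Parametrized by the drop [y] instead of the distance [travel c y], so that no inverse function
    enters and one expansion serves all the waves of speed [c]. *)
Definition crest_expansion (c : R) (main error : R -> R) : Prop :=
  exists C t, 0 < t /\ forall y, 0 < y < t ->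
    Rabs (y - main (travel c y)) <= C * error (travel c y).

(** The slowness grows from the crest with slope [K = sqrt ((1 + c) / (1 - c))], so [x = K y^2 / 2]
    to leading order and [y] is [sqrt (2 x / K)]; the fourth root is [1 / sqrt K]. *)
Lemma crest_expansion_sqrt (c : R) : -1 < c < 1 ->
  crest_expansion c
    (fun x => sqrt 2 * Rpower ((1 - c) / (1 + c)) (1 / 4) * sqrt x) (fun x => x).
Proof.
  intros Hc; pose proof (acos_gt_0 c ltac:(lra)) as HA.
  set (K := sqrt (1 - c ^ 2) / (1 - c)).
  set (C := 1 / (1 - c) + 16 / (1 - c) ^ 3).
  assert (HS : 0 < sqrt (1 - c ^ 2)) by (apply sqrt_lt_R0; nra).
  assert (HK : 0 < K) by (apply Rdiv_lt_0_compat; lra).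
  assert (HC : 0 < C).
  { apply Rplus_lt_0_compat; apply Rdiv_lt_0_compat; try lra; apply pow_lt; lra. }
  set (t0 := Rmin (acos c) ((1 - c) / 4)).
  assert (Ht0 : 0 < t0) by (apply Rmin_glb_lt; lra).
  assert (HKC : 0 < K / 4 / C) by (repeat apply Rdiv_lt_0_compat; lra).
  (* [t0] is the range of [slowness_crest]; [K / 4 / C] is the smallness that [sqrt_expansion] asks
     for. *)
  exists (8 * C / K ^ 2), (Rmin t0 (K / 4 / C)).
  split; [now apply Rmin_glb_lt|]; intros y [Hy0 Hy].
  assert (Hy1 := Rlt_le_trans _ _ _ Hy (Rmin_l _ _)).
  assert (Hy2 := Rlt_le_trans _ _ _ Hy (Rmin_r _ _)).
  assert (HT := travel_expansion c K C t0 1 ltac:(lra) (Rmin_l _ _)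
                  (fun z Hz => slowness_crest c z Hc Hz) y (conj Hy0 Hy1)).
  simpl Nat.add in HT; replace (INR 2) with 2 in HT by (simpl; ring).
  assert (HCy : C * y <= K / 4).
  { replace (K / 4) with (C * (K / 4 / C)) by (field; lra).
    apply Rmult_le_compat_l; lra. }
  apply (sqrt_expansion K); trivial.
  - repeat apply Rmult_le_pos; try apply sqrt_pos; left; apply exp_pos.
  - assert (Hx : 0 <= travel c y).
    { apply Rabs_le_between in HT.
      assert (0 < y ^ 2) by (apply pow_lt; lra).
      assert (C * y ^ 3 <= K / 4 * y ^ 2) by nra. nra. }
    set (r := Rpower ((1 - c) / (1 + c)) (1 / 4)).
    assert (Hr : r * r = / K).
    { unfold r; rewrite <- Rpower_plus.
      replace (1 / 4 + 1 / 4) with (/ 2) by field.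
      rewrite Rpower_sqrt by (apply Rdiv_lt_0_compat; lra).
      unfold K; rewrite Rinv_div.
      apply Rsqr_inj; [apply sqrt_pos|apply Rdiv_le_0_compat; lra|].
      rewrite Rsqr_sqrt by (apply Rdiv_le_0_compat; lra).
      rewrite Rsqr_div', Rsqr_sqrt by nra; unfold Rsqr.
      replace (1 - c ^ 2) with ((1 - c) * (1 + c)) by ring; field; lra. }
    transitivity ((sqrt 2 * sqrt 2) * (r * r)
      * (sqrt (travel c y) * sqrt (travel c y))); [ring|].
    rewrite !sqrt_sqrt, Hr by lra; field; lra.
Qed.

Lemma crest_expansion_cbrt :
  crest_expansion (-1)
    (fun x => Rpower 12 (1 / 3) * Rpower x (1 / 3)) (fun x => Rpower x (2 / 3)).
Proof.
  set (t0 := Rmin 1 (acos (-1))).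
  assert (Ht0 : 0 < t0) by (apply Rmin_glb_lt; [lra|apply acos_gt_0; lra]).
  (* Both constants come from [cbrt_expansion] with [C = 1], where [y < / 24] is its smallness
     hypothesis. *)
  exists 108, (Rmin t0 (/ 24)); split; [apply Rmin_glb_lt; lra|]; intros y [Hy0 Hy].
  assert (Hy1 := Rlt_le_trans _ _ _ Hy (Rmin_l _ _)).
  assert (Hy2 := Rlt_le_trans _ _ _ Hy (Rmin_r _ _)).
  assert (Hc : -1 <= -1 < 1) by lra.
  assert (HT := fun H => travel_expansion (-1) (/ 4) 1 t0 2
    Hc (Rmin_r _ _) H y (conj Hy0 Hy1)).
  simpl Nat.add in HT; replace (INR 3) with 3 in HT by (simpl; ring).
  assert (HT' : Rabs (travel (-1) y - y ^ 3 / 12) <= 1 * y ^ 4).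
  { replace (y ^ 3 / 12) with (/ 4 * y ^ 3 / 3) by field; apply HT.
    intros z [Hz0 Hz]; rewrite Rmult_1_l; apply (slowness_crest_pi z).
    split; [lra|apply Rlt_le_trans with (1 := Hz), Rmin_l]. }
  clear HT; set (x := travel (-1) y) in *.
  assert (Hx : 0 < x).
  { apply Rabs_le_between in HT'.
    assert (0 < y ^ 3) by (apply pow_lt; lra).
    assert (y ^ 4 <= / 24 * y ^ 3) by nra. lra. }
  assert (Hpow : forall a, 0 < a -> Rpower a (1 / 3) ^ 3 = a).
  { intros a Ha; rewrite <- Rpower_pow by apply exp_pos.
    rewrite Rpower_mult; replace (1 / 3 * INR 3) with 1 by (simpl; field).
    now apply Rpower_1. }
  replace (Rpower x (2 / 3)) with (Rpower x (1 / 3) ^ 2).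
  2:{ rewrite <- Rpower_pow by apply exp_pos; rewrite Rpower_mult.
      f_equal; simpl; field. }
  replace 108 with (108 * 1) by ring.
  apply (cbrt_expansion 1 x); trivial.
  - apply Rmult_lt_0_compat; apply exp_pos.
  - apply exp_pos.
  - rewrite Rpow_mult_distr, !Hpow by lra; ring.
  - now apply Hpow.
  - lra.
Qed.

(** * The waves *)

(** Take [y = acos c - s (phi x - k)]: this is [|phi x - phi 0|], and [travel c y = |x|]. Continuity
    makes [y] small, and [y > 0] off the crest, hence the punctured neighbourhood. *)
Lemma crest_expansion_transfer (c k s : R) (phi main error : R -> R) :
  s = 1 \/ s = -1 ->
  continuous phi 0 -> phi 0 = k + s * acos c ->
  (forall x, x <> 0 -> s * (phi x - k) < acos c) ->
  (forall x, travel c (acos c - s * (phi x - k)) = Rabs x) ->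
  crest_expansion c main error ->
  exists C, locally' 0 (fun x =>
    Rabs (Rabs (phi x - (k + s * acos c)) - main (Rabs (x - 0)))
      <= C * error (Rabs (x - 0))).
Proof.
  intros Hs Cphi phi0 Hlt HT [C [t [Ht H]]]; exists C.
  destruct (proj1 (filterlim_locally _ _) Cphi (mkposreal t Ht)) as [d Hd].
  exists d; intros x Hx Hx0; specialize (Hd x Hx); specialize (Hlt x Hx0).
  unfold ball in Hd; simpl in Hd; unfold AbsRing_ball, abs, minus, plus, opp in Hd;
    simpl in Hd; rewrite phi0 in Hd.
  rewrite Rminus_0_r, <- (HT x).
  assert (E : Rabs (phi x - (k + s * acos c)) = acos c - s * (phi x - k)).
  { destruct Hs; subst s; [rewrite Rabs_left1|rewrite Rabs_right]; lra. }
  rewrite E; apply H; change (phi x + - (k + s * acos c))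
    with (phi x - (k + s * acos c)) in Hd; lra.
Qed.

(** A finite lower bound of the range passes to the limit [l]; [p_infty] is excluded because the
    range is not empty. *)
Lemma glb_range_of_limit (f : R -> R) (l : R) :
  (forall x, l <= f x) -> is_lim f p_infty l -> is_glb_Rbar (range f) l.
Proof.
  intros Hf Hl; split; [intros y [x ->]; exact (Hf x)|].
  intros [b| |] Hb; [|elim (Hb (f 0)); now exists 0|exact I].
  apply (is_lim_le_loc (fun _ => b) f p_infty);
    [|apply is_lim_const|exact Hl].
  exists 0; intros x _; exact (Hb (f x) (ex_intro _ x eq_refl)).
Qed.

Lemma lub_range_of_limit (f : R -> R) (l : R) :
  (forall x, f x <= l) -> is_lim f p_infty l -> is_lub_Rbar (range f) l.
Proof.
  intros Hf Hl; split; [intros y [x ->]; exact (Hf x)|].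
  intros [b| |] Hb; [|exact I|elim (Hb (f 0)); now exists 0].
  apply (is_lim_le_loc f (fun _ => b) p_infty);
    [|exact Hl|apply is_lim_const].
  exists 0; intros x _; exact (Hb (f x) (ex_intro _ x eq_refl)).
Qed.

(** [main] and [error] stay abstract so that the square root and cube root laws share the
    construction. *)
Lemma exists_cusped (c : R) (n : Z) (main error : R -> R) :
  -1 <= c < 1 -> crest_expansion c main error ->
  exists phi : R -> R,
    cusped_wave c phi 0 /\
    is_lim phi p_infty (2 * IZR n * PI) /\
    is_lim phi m_infty (2 * IZR n * PI) /\
    is_max_at phi 0 (2 * IZR n * PI + acos c) /\
    is_glb_Rbar (range phi) (2 * IZR n * PI) /\
    exists C, locally' 0 (fun x =>
      Rabs (Rabs (phi x - (2 * IZR n * PI + acos c)) - main (Rabs (x - 0)))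
        <= C * error (Rabs (x - 0))).
Proof.
  intros Hc Hexp.
  destruct (exists_wave c n 1 Hc (or_introl eq_refl))
    as [phi [Hw [Hcusp [Hp [Hm [phi0 [Hb [Hlt [HT Cphi]]]]]]]]].
  exists phi; split; [now split|split; [|split; [|split; [|split]]]]; trivial.
  - split; [rewrite phi0; ring|intros x; specialize (Hb x); lra].
  - apply glb_range_of_limit; trivial; intros x; specialize (Hb x); lra.
  - rewrite <- (Rmult_1_l (acos c)).
    apply (crest_expansion_transfer c); auto.
Qed.

Lemma exists_anticusped (c : R) (n : Z) (main error : R -> R) :
  -1 <= c < 1 -> crest_expansion c main error ->
  exists phi : R -> R,
    anticusped_wave c phi 0 /\
    is_lim phi p_infty (2 * IZR n * PI) /\
    is_lim phi m_infty (2 * IZR n * PI) /\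
    is_min_at phi 0 (2 * IZR n * PI - acos c) /\
    is_lub_Rbar (range phi) (2 * IZR n * PI) /\
    exists C, locally' 0 (fun x =>
      Rabs (Rabs (phi x - (2 * IZR n * PI - acos c)) - main (Rabs (x - 0)))
        <= C * error (Rabs (x - 0))).
Proof.
  intros Hc Hexp.
  destruct (exists_wave c n (-1) Hc (or_intror eq_refl))
    as [phi [Hw [Hcusp [Hp [Hm [phi0 [Hb [Hlt [HT Cphi]]]]]]]]].
  assert (Hmin : is_min_at phi 0 (2 * IZR n * PI - acos c)).
  { split; [rewrite phi0; ring|intros x; specialize (Hb x); lra]. }
  exists phi; split; [|split; [|split; [|split; [|split]]]]; trivial.
  - split; [exact Hw|split; [exact Hcusp|]].
    apply filter_forall; intros x; destruct Hmin as [-> H]; apply H.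
  - apply lub_range_of_limit; trivial; intros x; specialize (Hb x); lra.
  - replace (2 * IZR n * PI - acos c) with (2 * IZR n * PI + -1 * acos c) by ring.
    apply (crest_expansion_transfer c); auto.
Qed.

Theorem proposition7p2 :
  (forall (c : R) (n : Z), -1 < c < 1 -> c <> 0 ->
     (exists (phi : R -> R) (xc : R),
        cusped_wave c phi xc /\
        is_lim phi p_infty (2 * IZR n * PI) /\
        is_lim phi m_infty (2 * IZR n * PI) /\
        is_max_at phi xc (2 * IZR n * PI + acos c) /\
        is_glb_Rbar (range phi) (2 * IZR n * PI) /\
        sqrt_asymptotics c phi xc (2 * IZR n * PI + acos c)) /\
     (exists (phi : R -> R) (xc : R),
        anticusped_wave c phi xc /\
        is_lim phi p_infty (2 * IZR n * PI) /\
        is_lim phi m_infty (2 * IZR n * PI) /\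
        is_min_at phi xc (2 * IZR n * PI - acos c) /\
        is_lub_Rbar (range phi) (2 * IZR n * PI) /\
        sqrt_asymptotics c phi xc (2 * IZR n * PI - acos c))) /\
  (forall n : Z,
     (exists (phi : R -> R) (xc : R),
        cusped_wave (-1) phi xc /\
        is_lim phi p_infty (2 * IZR n * PI) /\
        is_lim phi m_infty (2 * IZR n * PI) /\
        is_max_at phi xc ((2 * IZR n + 1) * PI) /\
        is_glb_Rbar (range phi) (2 * IZR n * PI) /\
        cbrt_asymptotics phi xc ((2 * IZR n + 1) * PI)) /\
     (exists (phi : R -> R) (xc : R),
        anticusped_wave (-1) phi xc /\
        is_lim phi p_infty (2 * IZR n * PI) /\
        is_lim phi m_infty (2 * IZR n * PI) /\
        is_min_at phi xc ((2 * IZR n - 1) * PI) /\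
        is_lub_Rbar (range phi) (2 * IZR n * PI) /\
        cbrt_asymptotics phi xc ((2 * IZR n - 1) * PI))).
Proof.
  (* [bigO_at] puts [Rabs] around the comparison function, which here is a positive [Rpower]. *)
  assert (Hbig : forall (phi : R -> R) (phi0 : R) C,
    locally' 0 (fun x =>
      Rabs (Rabs (phi x - phi0)
        - Rpower 12 (1 / 3) * Rpower (Rabs (x - 0)) (1 / 3))
        <= C * Rpower (Rabs (x - 0)) (2 / 3)) -> cbrt_asymptotics phi 0 phi0).
  { intros phi phi0 C H; exists C; revert H; apply filter_imp; intros x H.
    rewrite (Rabs_right (Rpower _ _)); [exact H|left; apply exp_pos]. }
  assert (Hpi : acos (-1) = PI).
  { replace (-1) with (- (1)) by ring; rewrite acos_opp, acos_1; ring. }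
  split.
  - intros c n Hc _; split.
    + destruct (exists_cusped c n _ _ ltac:(lra) (crest_expansion_sqrt c Hc))
        as [phi H]; exists phi, 0; exact H.
    + destruct (exists_anticusped c n _ _ ltac:(lra) (crest_expansion_sqrt c Hc))
        as [phi H]; exists phi, 0; exact H.
  - intros n.
    replace ((2 * IZR n + 1) * PI) with (2 * IZR n * PI + acos (-1))
      by (rewrite Hpi; ring).
    replace ((2 * IZR n - 1) * PI) with (2 * IZR n * PI - acos (-1))
      by (rewrite Hpi; ring).
    split.
    + destruct (exists_cusped (-1) n _ _ ltac:(lra) crest_expansion_cbrt)
        as [phi [H1 [H2 [H3 [H4 [H5 [C HC]]]]]]].
      exists phi, 0; repeat (split; [assumption|]); exact (Hbig _ _ _ HC).
    + destruct (exists_anticusped (-1) n _ _ ltac:(lra) crest_expansion_cbrt)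
        as [phi [H1 [H2 [H3 [H4 [H5 [C HC]]]]]]].
      exists phi, 0; repeat (split; [assumption|]); exact (Hbig _ _ _ HC).
Qed.
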